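(* Let $$U(z)=\frac{1}{2\pi i}\int_{|w|=1}w\exp\left\{\frac{z}{w}-\frac{1}{2w^2}-\frac{w^2}{2}\right\}dw .$$ Then the following statements hold. (a) $U(z)$ has its largest growth in both directions of the imaginary axis: for $r>0$, $$|U(ir)|=|U(-ir)|=M(r,U),$$ and there is a constant $c_0>0$ such that $$\log M(r,U)=(c_0+o(1))\,r^{2/3}\quad\text{as } r\to\infty .$$ (b) $U(z)$ does not have any zeros on the imaginary axis.
   Context: The circle $|w|=1$ is traversed once counterclockwise. For an entire function $f$, $M(r,f)=\max_{|z|=r}|f(z)|$. *)

(* Defs.v *)
From Stdlib Require Import Reals Lra.
From Coquelicot Require Import Coquelicot.
Open Scope R_scope.
Open Scope C_scope.

Definition Cexp (z : C) : C :=
  RtoC (exp (Re z)) * (cos (Im z), sin (Im z)).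

(* C is not registered in Coquelicot as a complete normed module over R, so
   RInt does not apply to f : R -> C directly; the integral is therefore
   taken componentwise, in agreement with is_RInt (lemma C_RInt_correct). *)
Definition C_RInt (f : R -> C) (a b : R) : C :=
  (RInt (fun t => Re (f t)) a b, RInt (fun t => Im (f t)) a b).

Lemma C_RInt_correct (f : R -> C) (a b : R) :
  ex_RInt (V := C_R_NormedModule) f a b ->
  is_RInt (V := C_R_NormedModule) f a b (C_RInt f a b).
Proof.
intros [l Hl].
assert (H1 : is_RInt (fun t => Re (f t)) a b (Re l)).
{ exact (is_RInt_fct_extend_fst (U := R_NormedModule) (V := R_NormedModule)
           f a b l Hl). }
assert (H2 : is_RInt (fun t => Im (f t)) a b (Im l)).
{ exact (is_RInt_fct_extend_snd (U := R_NormedModule) (V := R_NormedModule)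
           f a b l Hl). }
unfold C_RInt.
rewrite (is_RInt_unique _ _ _ _ H1), (is_RInt_unique _ _ _ _ H2).
destruct l; exact Hl.
Qed.

(* Integral over |w| = 1, traversed once counterclockwise by
   w = exp(i t), 0 <= t <= 2 pi, so that dw = i exp(i t) dt. *)
Definition unit_circle_integral (f : C -> C) : C :=
  C_RInt (fun t : R => f (Cexp (Ci * t)) * (Ci * Cexp (Ci * t))) 0 (2 * PI).

Definition is_max_modulus (r : R) (f : C -> C) (m : R) : Prop :=
  (exists z : C, Cmod z = r /\ Cmod (f z) = m) /\
  (forall z : C, Cmod z = r -> (Cmod (f z) <= m)%R).

(* The real number m such that is_max_modulus r f m. It is meaningful only
   when the maximum exists, as it does for r >= 0 and f continuous. *)
Definition max_modulus (r : R) (f : C -> C) : R :=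
  iota (is_max_modulus r f).

Lemma max_modulus_unique (r : R) (f : C -> C) (m : R) :
  is_max_modulus r f m -> max_modulus r f = m.
Proof.
intros Hm.
assert (Huniq : forall x, is_max_modulus r f x -> x = m).
{ intros x [[z [Hz Ez]] Hx]; destruct Hm as [[y [Hy Ey]] Hm].
  apply Rle_antisym.
  - rewrite <- Ez; auto.
  - rewrite <- Ey; auto. }
apply Huniq.
apply (iota_correct (V := R_CompleteNormedModule) (is_max_modulus r f)).
exists m; split; [exact Hm | intros x Hx; symmetry; auto].
Qed.

Definition U (z : C) : C :=
  / (2 * PI * Ci) *
  unit_circle_integral
    (fun w => w * Cexp (z / w - 1 / (2 * w ^ 2) - w ^ 2 / 2)).

(* Main.v *)
Require Import Defs.
From Stdlib Require Import Reals Factorial Lra Lia.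
From Coquelicot Require Import Coquelicot.
Open Scope R_scope.

(** On |w| = 1 the factor exp(-1/(2w^2) - w^2/2) is exp(-cos 2t), so expanding
    exp(z/w) gives U(z) = sum_m (-1)^(m-1) I_{|m-1|}(1) z^(2m) / (2m)!, with
    I_k the modified Bessel functions. Since I_k(1) > 0, at z = ir and z = -ir
    all the terms have the same sign and add up to the largest possible
    modulus; in particular U has no zero there.

    For the growth, I_k(1) equals 2^(-k)/k! up to a factor at most polynomial
    in k, so that log M(r,U) is governed by the terms r^(2m)/(2^m m! (2m)!).
    The bound 2^(-k)/k! <= q^(-2k) exp(q^2/2), used with q = r^(1/3), turns the
    series into a subseries of exp(r/q) and yields the upper bound
    (3/2) r^(2/3) + O(log r); the single term m = floor(r^(2/3)/2) yields the
    matching lower bound. *)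

(** * Linearity of the integral and integrals of exact derivatives *)

Lemma ex_RInt_of_derivable (f : R -> R) (a b : R) :
  (forall t, ex_derive f t) -> ex_RInt f a b.
Proof.
intros Hf; apply (ex_RInt_continuous (V := R_CompleteNormedModule)).
intros t _; apply (ex_derive_continuous (V := R_NormedModule)), Hf.
Qed.

Lemma RInt_linear (f g : R -> R) (p q a b : R) :
  ex_RInt f a b -> ex_RInt g a b ->
  RInt (fun t => p * f t + q * g t) a b = p * RInt f a b + q * RInt g a b.
Proof.
intros Hf Hg.
apply is_RInt_unique.
apply (is_RInt_plus (V := R_NormedModule) (fun t => p * f t) (fun t => q * g t)).
- apply (is_RInt_scal (V := R_NormedModule)).
  now apply (RInt_correct (V := R_CompleteNormedModule)).
- apply (is_RInt_scal (V := R_NormedModule)).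
  now apply (RInt_correct (V := R_CompleteNormedModule)).
Qed.

(** Integration by parts over a full period: the moment identities below come from exhibiting a
    periodic antiderivative [F]. *)
Lemma RInt_derive_zero (F f : R -> R) (a b : R) :
  (forall t, is_derive F t (f t)) -> (forall t, ex_derive f t) ->
  F a = F b -> RInt f a b = 0.
Proof.
intros HF Hf Hab.
apply is_RInt_unique.
replace 0 with (minus (F b) (F a))
  by (rewrite Hab; apply (minus_eq_zero (G := R_AbelianGroup))).
apply (is_RInt_derive (V := R_CompleteNormedModule)); intros t _.
- apply HF.
- apply (ex_derive_continuous (V := R_NormedModule)), Hf.
Qed.

(** * Moments of the weight exp(-cos 2t) and modified Bessel values *)

Lemma sin_nat_2PI (n : nat) : sin (INR n * (2 * PI)) = 0.
Proof.
replace (INR n * (2 * PI)) with (0 + 2 * INR n * PI) by ring.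
now rewrite sin_period, sin_0.
Qed.

Definition cos_moment (m : nat) : R :=
  RInt (fun t => exp (- cos (2 * t)) * cos (INR (2 * m) * t)) 0 (2 * PI).

(* [2 PI] times the modified Bessel function [I_m] at 1, with the integration
   variable [u] replaced by [2 t + PI]. *)
Definition bessel (m : nat) : R := (-1) ^ m * cos_moment m.

(** The integrand is visibly nonnegative, unlike that of [cos_moment]; positivity of the Bessel
    values is read off from this form. *)
Definition sin_moment (m : nat) : R :=
  RInt (fun t => exp (- cos (2 * t)) * sin (2 * t) ^ (2 * m)) 0 (2 * PI).

Lemma ex_RInt_weight_cos (a c d : R) :
  ex_RInt (fun t => exp (- cos (2 * t)) * cos (a * t)) c d.
Proof.
apply ex_RInt_of_derivable; intros t; auto_derive; auto.
Qed.

Lemma ex_RInt_weight_sin (n : nat) (c d : R) :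
  ex_RInt (fun t => exp (- cos (2 * t)) * sin (2 * t) ^ n) c d.
Proof.
apply ex_RInt_of_derivable; intros t; auto_derive; auto.
Qed.

(** The classical relation I_{k-1}(x) - I_{k+1}(x) = (2k/x) I_k(x) at x = 1, k = n + 1. It results
    from differentiating exp(-cos 2t) sin(2kt) and turning the product 2 sin(2t) sin(2kt) into a
    difference of cosines. *)
Lemma bessel_rec (n : nat) :
  bessel n = bessel (S (S n)) + 2 * INR (S n) * bessel (S n).
Proof.
unfold bessel.
assert (H : 1 * (1 * cos_moment n + -1 * cos_moment (S (S n)))
  + 2 * INR (S n) * cos_moment (S n) = 0).
{ unfold cos_moment.
  rewrite <- RInt_linear by apply ex_RInt_weight_cos.
  rewrite <- RInt_linear.
  2:{ apply ex_RInt_of_derivable; intros t; auto_derive; auto. }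
  2:{ apply ex_RInt_weight_cos. }
  apply RInt_derive_zero with
    (fun t => exp (- cos (2 * t)) * sin (INR (2 * S n) * t)).
  - intros t.
    replace (INR (2 * n) * t) with (INR (2 * S n) * t - 2 * t)
      by (rewrite !mult_INR, !S_INR; simpl INR; ring).
    replace (INR (2 * S (S n)) * t) with (INR (2 * S n) * t + 2 * t)
      by (rewrite !mult_INR, !S_INR; simpl INR; ring).
    rewrite cos_minus, cos_plus, mult_INR; simpl (INR 2).
    generalize (INR (S n)); intros a; auto_derive; [auto|]; ring.
  - intros t; auto_derive; auto.
  - rewrite !Rmult_0_r, sin_0, sin_nat_2PI; ring. }
simpl pow.
replace (cos_moment n) with (cos_moment (S (S n)) - 2 * INR (S n) * cos_moment (S n))
  by lra.
ring.
Qed.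

(** Dividing [sin_moment] by [odd_fact] turns this into [bessel_rec], so the two families coincide
    as soon as they agree at 0 and 1. *)
Lemma sin_moment_rec (n : nat) :
  sin_moment (S (S n)) =
  (2 * INR n + 3) * ((2 * INR n + 1) * sin_moment n - 2 * INR (S n) * sin_moment (S n)).
Proof.
assert (Hn : 2 * INR n + 3 <> 0) by (pose proof (pos_INR n); lra).
set (w := fun t => exp (- cos (2 * t))).
set (g := fun m t => w t * sin (2 * t) ^ (2 * m)).
assert (Hg : forall m, ex_RInt (g m) 0 (2 * PI)) by (intros m; apply ex_RInt_weight_sin).
assert (H : 1 * ((2 * INR n + 1) * sin_moment n + (- 2 * INR (S n)) * sin_moment (S n))
  + (- / (2 * INR n + 3)) * sin_moment (S (S n)) = 0).
{ unfold sin_moment; fold w.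
  change (fun t => w t * sin (2 * t) ^ (2 * n)) with (g n).
  change (fun t => w t * sin (2 * t) ^ (2 * S n)) with (g (S n)).
  change (fun t => w t * sin (2 * t) ^ (2 * S (S n))) with (g (S (S n))).
  rewrite <- RInt_linear by apply Hg.
  rewrite <- RInt_linear; [| |apply Hg].
  2:{ apply ex_RInt_of_derivable; intros t; unfold g, w; auto_derive; auto. }
  (* The odd exponents are given opaque names while the derivative is computed. *)
  destruct (ex_intro (fun p => p = 2 * n + 1)%nat _ eq_refl) as [p Hp].
  destruct (ex_intro (fun q => q = 2 * n + 3)%nat _ eq_refl) as [q Hq].
  (* The second summand is chosen to cancel the term sin^(2n+2) cos produced by differentiating the
     weight in the first one; only even powers of the sine remain once cos^2 is replaced by 1 -
     sin^2. *)
  apply RInt_derive_zero with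
    (fun t => / 2 * (w t * (sin (2 * t) ^ p * cos (2 * t)
       - / (2 * INR n + 3) * sin (2 * t) ^ q))).
  - intros t; unfold g, w; auto_derive; [auto|].
    replace (Nat.pred p) with (2 * n)%nat by lia.
    replace (Nat.pred q) with (2 * n + 2)%nat by lia.
    rewrite Hp, Hq.
    replace (2 * S n)%nat with (2 * n + 2)%nat by lia.
    replace (2 * S (S n))%nat with (2 * n + 4)%nat by lia.
    rewrite !pow_add, !plus_INR, !mult_INR, !S_INR; simpl (INR 0).
    pose proof (sin2_cos2 (2 * t)) as Hsc; unfold Rsqr in Hsc.
    clear Hg g Hp Hq p q w.
    generalize dependent (sin (2 * t) ^ (2 * n)); intros P.
    generalize (exp (- cos (2 * t))); intros E; revert Hsc.
    generalize (sin (2 * t)), (cos (2 * t)); intros s c Hsc.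
    simpl pow.
    transitivity (E * P * ((2 * INR n + 1) * (c * c) - s * s
      - / (2 * INR n + 3) * (s * s * (s * s)))).
    + field; exact Hn.
    + replace (c * c) with (1 - s * s) by lra; field; exact Hn.
  - intros t; unfold g, w; auto_derive; auto.
  - rewrite !Rmult_0_r, sin_0.
    replace (sin (2 * (2 * PI))) with 0 by (symmetry; apply (sin_nat_2PI 2)).
    rewrite !pow_i by lia; ring. }
apply (Rmult_eq_reg_l (/ (2 * INR n + 3))); [|now apply Rinv_neq_0_compat].
transitivity ((2 * INR n + 1) * sin_moment n - 2 * INR (S n) * sin_moment (S n)); [lra|].
field; lra.
Qed.

Lemma sin_moment_0 : sin_moment 0 = bessel 0.
Proof.
unfold sin_moment, bessel, cos_moment; rewrite pow_O, Rmult_1_l.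
apply RInt_ext; intros t _; simpl; rewrite Rmult_0_l, cos_0; ring.
Qed.

Lemma sin_moment_1 : sin_moment 1 = bessel 1.
Proof.
unfold sin_moment, bessel, cos_moment; rewrite pow_1.
apply Rminus_diag_uniq.
transitivity (1 * RInt (fun t => exp (- cos (2 * t)) * sin (2 * t) ^ (2 * 1)) 0 (2 * PI)
  + 1 * RInt (fun t => exp (- cos (2 * t)) * cos (INR (2 * 1) * t)) 0 (2 * PI)); [ring|].
rewrite <- RInt_linear; [|apply ex_RInt_weight_sin|apply ex_RInt_weight_cos].
apply RInt_derive_zero with (fun t => / 2 * (exp (- cos (2 * t)) * sin (2 * t))).
- intros t; auto_derive; [auto|].
  change (INR (2 * 1)) with (1 + 1); replace (1 + 1) with 2 by ring; simpl; field.
- intros t; auto_derive; auto.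
- rewrite !Rmult_0_r, sin_0.
  replace (sin (2 * (2 * PI))) with 0 by (symmetry; apply (sin_nat_2PI 2)); ring.
Qed.

(** The double factorial (2m - 1)!!, with value 1 at m = 0. *)
Fixpoint odd_fact (m : nat) : R :=
  match m with O => 1 | S k => (2 * INR k + 1) * odd_fact k end.

Lemma odd_fact_pos (m : nat) : 0 < odd_fact m.
Proof.
induction m as [|m IH]; simpl; [lra|].
apply Rmult_lt_0_compat; [pose proof (pos_INR m); lra | exact IH].
Qed.

(* Poisson's integral representation of [I_m]. *)
Lemma bessel_sin_moment (m : nat) : odd_fact m * bessel m = sin_moment m.
Proof.
enough (odd_fact m * bessel m = sin_moment m /\
        odd_fact (S m) * bessel (S m) = sin_moment (S m)) by easy.
induction m as [|m [IH1 IH2]].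
- rewrite sin_moment_0, sin_moment_1; simpl; lra.
- split; [exact IH2|].
  rewrite sin_moment_rec, <- IH1, <- IH2, (bessel_rec m).
  change (odd_fact (S (S m))) with ((2 * INR (S m) + 1) * odd_fact (S m)).
  change (odd_fact (S m)) with ((2 * INR m + 1) * odd_fact m).
  rewrite S_INR; ring.
Qed.

Lemma bessel_nonneg (m : nat) : 0 <= bessel m.
Proof.
apply (Rmult_le_reg_l (odd_fact m)); [apply odd_fact_pos|].
rewrite Rmult_0_r, bessel_sin_moment.
apply RInt_ge_0.
- pose proof PI_RGT_0; lra.
- apply ex_RInt_weight_sin.
- intros t _; apply Rmult_le_pos; [left; apply exp_pos|].
  rewrite pow_mult; apply pow_le, pow2_ge_0.
Qed.

Lemma bessel_0_pos : 0 < bessel 0.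
Proof.
rewrite <- sin_moment_0.
apply RInt_gt_0.
- pose proof PI_RGT_0; lra.
- intros t _; simpl; rewrite Rmult_1_r; apply exp_pos.
- intros t _; apply (ex_derive_continuous (V := R_NormedModule)).
  auto_derive; auto.
Qed.

(** * Two-sided bounds for the Bessel values *)

(** Dropping the nonnegative [bessel (S (S m))] from the recurrence leaves 2(m+1) I_{m+1} <= I_m,
    which is iterated. *)
Lemma bessel_upper (m : nat) : bessel m <= bessel 0 * ((/ 2) ^ m / INR (fact m)).
Proof.
induction m as [|m IH].
- simpl; lra.
- assert (Hm : 0 < INR (S m)) by (apply lt_0_INR; lia).
  pose proof (bessel_rec m) as Hr; pose proof (bessel_nonneg (S (S m))) as Hp.
  rewrite fact_simpl, mult_INR; simpl pow.
  apply (Rmult_le_reg_l (2 * INR (S m))); [lra|].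
  apply Rle_trans with (bessel m); [lra|].
  eapply Rle_trans; [exact IH|].
  apply Req_le; field; split; [apply INR_fact_neq_0|lra].
Qed.

Lemma bessel_le_0 (m : nat) : bessel m <= bessel 0.
Proof.
induction m as [|m IH]; [lra|].
pose proof (bessel_rec m) as Hr; pose proof (bessel_nonneg (S (S m))) as Hp.
pose proof (bessel_nonneg (S m)) as Hq.
rewrite S_INR in Hr; pose proof (pos_INR m).
assert (0 <= INR m * bessel (S m)) by now apply Rmult_le_pos.
lra.
Qed.

(** The recurrence at m + 1 bounds I_{m+2} by I_{m+1}, so the recurrence at m gives I_m <= 2(m+2)
    I_{m+1}. Iterating produces the denominator 2^m (m+1)!, which loses only a factor m + 1 against
    the upper bound. *)
Lemma bessel_lower (m : nat) :
  bessel 0 * ((/ 2) ^ m / (INR (fact m) * INR (S m))) <= bessel m.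
Proof.
induction m as [|m IH].
- simpl; lra.
- assert (Hm : 0 < INR (S m)) by (apply lt_0_INR; lia).
  pose proof (bessel_rec m) as H0; pose proof (bessel_rec (S m)) as H1.
  pose proof (bessel_nonneg (S (S m))) as Hp.
  pose proof (bessel_nonneg (S m)) as Hq.
  pose proof (bessel_nonneg (S (S (S m)))) as Hs.
  rewrite (S_INR (S m)) in *.
  assert (0 <= INR (S m) * bessel (S (S m))) by (apply Rmult_le_pos; lra).
  rewrite fact_simpl, mult_INR; simpl pow.
  apply (Rmult_le_reg_l (2 * (INR (S m) + 1))); [lra|].
  apply Rle_trans with (bessel m); [|lra].
  eapply Rle_trans; [|exact IH].
  apply Req_le; field; repeat split; try lra; apply INR_fact_neq_0.
Qed.

Lemma bessel_pos (m : nat) : 0 < bessel m.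
Proof.
eapply Rlt_le_trans; [|apply bessel_lower].
apply Rmult_lt_0_compat; [apply bessel_0_pos|].
apply Rdiv_lt_0_compat; [apply pow_lt; lra|].
apply Rmult_lt_0_compat; [apply INR_fact_lt_0|apply lt_0_INR; lia].
Qed.

(** * Symmetries of the weight and the Taylor coefficients of U *)

Lemma exp_le_compat (x y : R) : x <= y -> exp x <= exp y.
Proof.
intros [H| ->]; [left; now apply exp_increasing|apply Rle_refl].
Qed.

Lemma RInt_eq (f g : R -> R) (a b : R) :
  (forall t, f t = g t) -> RInt f a b = RInt g a b.
Proof. intros H; apply RInt_ext; intros t _; apply H. Qed.

Lemma RInt_reflect_zero (f : R -> R) (c : R) :
  ex_RInt f 0 c -> (forall t, f (c - t) = - f t) -> RInt f 0 c = 0.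
Proof.
intros Hf Hanti.
pose proof (RInt_comp_lin f (-1) c 0 c) as H.
replace (-1 * 0 + c) with c in H by ring.
replace (-1 * c + c) with 0 in H by ring.
specialize (H (ex_RInt_swap _ _ _ Hf)).
rewrite <- (opp_RInt_swap f 0 c) in H by exact Hf.
rewrite (RInt_ext _ f) in H.
- change (RInt f 0 c = - RInt f 0 c) in H; lra.
- intros t _; change (-1 * f (-1 * t + c) = f t).
  replace (-1 * t + c) with (c - t) by ring; rewrite Hanti; ring.
Qed.

Lemma RInt_shift_zero (f : R -> R) (c : R) :
  (forall a b, ex_RInt f a b) -> (forall t, f (t + c) = - f t) ->
  RInt f 0 (2 * c) = 0.
Proof.
intros Hf Hanti.
rewrite <- (RInt_Chasles f 0 c (2 * c)) by apply Hf.
pose proof (RInt_comp_lin f 1 c 0 c (Hf _ _)) as H.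
replace (1 * 0 + c) with c in H by ring.
replace (1 * c + c) with (2 * c) in H by ring.
rewrite <- H.
rewrite (RInt_ext (fun t => scal 1 (f (1 * t + c))) (fun t => opp (f t))).
- rewrite (RInt_opp (V := R_CompleteNormedModule)) by apply Hf.
  apply (plus_opp_r (G := R_AbelianGroup)).
- intros t _; change (1 * f (1 * t + c) = - f t).
  rewrite !Rmult_1_l; apply Hanti.
Qed.

Lemma cos_nat_2PI (n : nat) : cos (INR n * (2 * PI)) = 1.
Proof.
replace (INR n * (2 * PI)) with (0 + 2 * INR n * PI) by ring.
now rewrite cos_period, cos_0.
Qed.

Lemma cos_weight_reflect (t : R) : cos (2 * (2 * PI - t)) = cos (2 * t).
Proof.
replace (2 * (2 * PI - t)) with (- (2 * t) + 2 * INR 2 * PI) by (simpl; ring).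
now rewrite cos_period, cos_neg.
Qed.

Lemma RInt_weight_sin (n : nat) :
  RInt (fun t => exp (- cos (2 * t)) * sin (INR n * t)) 0 (2 * PI) = 0.
Proof.
apply RInt_reflect_zero.
- apply ex_RInt_of_derivable; intros t; generalize (INR n); intros a.
  auto_derive; auto.
- intros t; rewrite cos_weight_reflect, Rmult_minus_distr_l, sin_minus.
  rewrite sin_nat_2PI, cos_nat_2PI; ring.
Qed.

(** After expanding the cosine of the difference, the sine part integrates to zero by the symmetry t
    -> 2 PI - t of the weight. *)
Lemma RInt_weight_cos (n : nat) (b : R) :
  (RInt (fun t => exp (- cos (2 * t)) * cos (b - INR n * t)) 0 (2 * PI) : R) =
  cos b * RInt (fun t => exp (- cos (2 * t)) * cos (INR n * t)) 0 (2 * PI).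
Proof.
transitivity
  (cos b * RInt (fun t => exp (- cos (2 * t)) * cos (INR n * t)) 0 (2 * PI)
   + sin b * RInt (fun t => exp (- cos (2 * t)) * sin (INR n * t)) 0 (2 * PI)).
- rewrite <- RInt_linear.
  + apply RInt_eq; intros t; rewrite cos_minus; ring.
  + apply ex_RInt_weight_cos.
  + apply ex_RInt_of_derivable; intros t; generalize (INR n); intros a.
    auto_derive; auto.
- rewrite RInt_weight_sin; ring.
Qed.

(** With w = e^{it}, this is the real part of e^{ia} times the integral of the weight against w^2
    (e^{i th} / w)^k. The factor w^2 combines the w of the integrand with dw = i w dt. The angle a =
    0 gives the real part and a = PI/2 minus the imaginary part. *)
Definition phase_coef (a th : R) (k : nat) : R :=
  RInt (fun t => exp (- cos (2 * t)) * cos (a + 2 * t + INR k * (th - t))) 0 (2 * PI).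

(** Shifting t by PI replaces w by -w: the weight is unchanged and w^(2-k) changes sign for odd k.
    Hence U is even. *)
Lemma phase_coef_odd (a th : R) (m : nat) : phase_coef a th (2 * m + 1) = 0.
Proof.
apply RInt_shift_zero.
- intros c d; apply ex_RInt_of_derivable; intros t.
  generalize (INR (2 * m + 1)); intros k; auto_derive; auto.
- intros t.
  replace (2 * (t + PI)) with (2 * t + 2 * INR 1 * PI) by (simpl; ring).
  rewrite cos_period.
  rewrite plus_INR, mult_INR; simpl (INR 1); simpl (INR 2).
  rewrite Ropp_mult_distr_r; f_equal.
  rewrite <- neg_cos, <- (cos_period _ m); f_equal; ring.
Qed.

(* Up to the sign [(-1) ^ (m + 1)], [2 PI (2 m)!] times the coefficient of
   [z ^ (2 m)] in [U]; since [I_{-1} = I_1], the case [m = 0] is special. *)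
Definition kappa (m : nat) : R :=
  match m with O => bessel 1 | S j => bessel j end.

(** For k = 2m the variable t enters the phase with frequency -2(m - 1), so the integral is a cosine
    moment of index |m - 1|, and the sign (-1)^(m+1) converts it to a Bessel value. *)
Lemma phase_coef_even (a th : R) (m : nat) :
  phase_coef a th (2 * m) = (-1) ^ S m * cos (a + INR (2 * m) * th) * kappa m.
Proof.
destruct m as [|j].
(* For m = 0 the frequency is +2; evenness of the cosine brings it to the form [b - INR 2 * t]. *)
- unfold phase_coef, kappa, bessel, cos_moment.
  rewrite (RInt_eq _ (fun t => exp (- cos (2 * t)) * cos (- a - INR (2 * 1) * t))).
  + rewrite RInt_weight_cos, cos_neg, Nat.mul_0_r; simpl (INR 0).
    rewrite Rmult_0_l, Rplus_0_r; ring.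
  + intros t; f_equal; rewrite <- cos_neg; f_equal; simpl; ring.
- unfold phase_coef, kappa, bessel, cos_moment.
  rewrite (RInt_eq _ (fun t => exp (- cos (2 * t)) *
    cos ((a + INR (2 * S j) * th) - INR (2 * j) * t))).
  + rewrite RInt_weight_cos.
    replace ((-1) ^ S (S j)) with ((-1) ^ j) by (simpl; ring).
    transitivity ((-1) ^ j * (-1) ^ j * (cos (a + INR (2 * S j) * th) *
      RInt (fun t => exp (- cos (2 * t)) * cos (INR (2 * j) * t)) 0 (2 * PI))).
    * rewrite <- Rpow_mult_distr; replace (-1 * -1) with 1 by ring; rewrite pow1; ring.
    * ring.
  + intros t; do 2 f_equal; rewrite !mult_INR, !S_INR; simpl (INR 0); ring.
Qed.

Lemma kappa_pos (m : nat) : 0 < kappa m.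
Proof. destruct m; apply bessel_pos. Qed.

(** * Taylor expansion in rho and termwise integration *)

(** The real part of exp(ib + x e^{ia}); each differentiation in x multiplies by e^{ia}, that is,
    shifts b by a. *)
Definition exp_cos (a b x : R) : R := exp (x * cos a) * cos (b + x * sin a).

Lemma is_derive_n_exp_cos (a b : R) (n : nat) (x : R) :
  is_derive_n (exp_cos a b) n x (exp_cos a (b + INR n * a) x).
Proof.
revert x; induction n as [|n IH]; intros x.
- simpl; f_equal; ring.
- change (is_derive (Derive_n (exp_cos a b) n) x (exp_cos a (b + INR (S n) * a) x)).
  apply (is_derive_ext (exp_cos a (b + INR n * a))).
  { intros t; symmetry; apply is_derive_n_unique, IH. }
  rewrite S_INR; unfold exp_cos.
  replace (b + (INR n + 1) * a + x * sin a) with (b + INR n * a + x * sin a + a) by ring.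
  rewrite (cos_plus _ a).
  generalize (b + INR n * a); intros c.
  auto_derive; [auto|ring].
Qed.

(** Lagrange remainder: every derivative at a point zeta of [0, x] is at most exp(zeta) <= exp(x) in
    absolute value. *)
Lemma taylor_exp_cos (a b x : R) (n : nat) :
  0 <= x ->
  Rabs (exp_cos a b x
    - sum_f_R0 (fun k => x ^ k / INR (fact k) * cos (b + INR k * a)) n)
  <= exp x * (x ^ S n / INR (fact (S n))).
Proof.
intros Hx.
destruct (Rle_lt_or_eq_dec _ _ Hx) as [Hx0|<-].
- destruct (Taylor_Lagrange (exp_cos a b) n 0 x Hx0) as [zeta [Hz E]].
  { intros t _ k _; destruct k as [|k]; [exact I|].
    exists (exp_cos a (b + INR (S k) * a) t); apply (is_derive_n_exp_cos a b (S k)). }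
  rewrite E, (is_derive_n_unique _ _ _ _ (is_derive_n_exp_cos a b (S n) zeta)).
  rewrite Rminus_0_r.
  rewrite (sum_eq _ (fun k => x ^ k / INR (fact k) * cos (b + INR k * a))).
  2:{ intros k _; rewrite (is_derive_n_unique _ _ _ _ (is_derive_n_exp_cos a b k 0)).
      unfold exp_cos; rewrite !Rmult_0_l, exp_0, Rplus_0_r; ring. }
  match goal with |- Rabs (?A + ?B - ?A) <= _ => replace (A + B - A) with B by ring end.
  assert (Hq : 0 <= x ^ S n / INR (fact (S n))).
  { apply Rdiv_le_0_compat; [now apply pow_le|apply INR_fact_lt_0]. }
  rewrite Rabs_mult, (Rabs_pos_eq _ Hq), Rmult_comm.
  apply Rmult_le_compat_r; [exact Hq|].
  unfold exp_cos; rewrite Rabs_mult, (Rabs_pos_eq (exp _)) by (left; apply exp_pos).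
  pose proof (COS_bound a) as Ha.
  set (u := b + INR (S n) * a + zeta * sin a).
  assert (Hu : Rabs (cos u) <= 1) by (apply Rabs_le, COS_bound).
  apply Rle_trans with (exp (zeta * cos a) * 1).
  + apply Rmult_le_compat_l; [left; apply exp_pos|exact Hu].
  + rewrite Rmult_1_r; apply exp_le_compat; apply Rle_trans with (zeta * 1); [|lra].
    apply Rmult_le_compat_l; lra.
(* At x = 0 there is no open interval for the Lagrange form; the sum reduces to its term k = 0,
   where 0^0 = 1. *)
- assert (E : sum_f_R0 (fun k => 0 ^ k / INR (fact k) * cos (b + INR k * a)) n = cos b).
  { induction n as [|n IH].
    - simpl; rewrite Rmult_0_l, Rplus_0_r; field.
    - simpl sum_f_R0; rewrite IH, Rmult_0_l; unfold Rdiv; ring. }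
  unfold exp_cos; rewrite E, !Rmult_0_l, exp_0, Rplus_0_r, Rmult_1_l, Rminus_diag, Rabs_R0.
  rewrite pow_i by lia; unfold Rdiv; lra.
Qed.

Lemma is_RInt_sum_f_R0 (f : nat -> R -> R) (a b : R) (n : nat) :
  (forall k, ex_RInt (f k) a b) ->
  is_RInt (fun t => sum_f_R0 (fun k => f k t) n) a b
    (sum_f_R0 (fun k => RInt (f k) a b) n).
Proof.
intros Hf; induction n as [|n IH]; simpl.
- apply (RInt_correct (V := R_CompleteNormedModule)), Hf.
- apply (is_RInt_plus (V := R_NormedModule)); [exact IH|].
  apply (RInt_correct (V := R_CompleteNormedModule)), Hf.
Qed.

Lemma sum_f_R0_pairs (f : nat -> R) (n : nat) :
  sum_f_R0 f (2 * n + 1) = sum_f_R0 (fun m => f (2 * m)%nat + f (2 * m + 1)%nat) n.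
Proof.
induction n as [|n IH]; [reflexivity|].
replace (2 * S n + 1)%nat with (S (S (2 * n + 1))) by lia.
rewrite !tech5, IH.
replace (S (2 * n + 1)) with (2 * S n)%nat by lia.
replace (S (2 * S n)) with (2 * S n + 1)%nat by lia.
ring.
Qed.

(** 2 PI times the real part of e^{ia} U(rho e^{i th}). *)
Definition phase_integral (a rho th : R) : R :=
  RInt (fun t => exp (rho * cos (th - t) - cos (2 * t))
    * cos (a + 2 * t + rho * sin (th - t))) 0 (2 * PI).

(** The pointwise Taylor bound is integrated over an interval of length 2 PI, the weight being at
    most e. Only finite sums are exchanged with the integral. *)
Lemma phase_integral_taylor (a rho th : R) (n : nat) :
  0 <= rho ->
  Rabs (phase_integral a rho th
    - sum_f_R0 (fun k => rho ^ k / INR (fact k) * phase_coef a th k) n)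
  <= 2 * PI * (exp 1 * (exp rho * (rho ^ S n / INR (fact (S n))))).
Proof.
intros Hrho.
set (f := fun t => exp (rho * cos (th - t) - cos (2 * t))
    * cos (a + 2 * t + rho * sin (th - t))).
set (g := fun k t => rho ^ k / INR (fact k) *
  (exp (- cos (2 * t)) * cos (a + 2 * t + INR k * (th - t)))).
assert (Hc : forall k, ex_RInt (fun t => exp (- cos (2 * t))
  * cos (a + 2 * t + INR k * (th - t))) 0 (2 * PI)).
{ intros k; apply ex_RInt_of_derivable; intros t; generalize (INR k); intros c.
  auto_derive; auto. }
assert (Hg : forall k, ex_RInt (g k) 0 (2 * PI)).
{ intros k; apply (ex_RInt_scal (V := R_NormedModule)), Hc. }
assert (Hf : is_RInt f 0 (2 * PI) (phase_integral a rho th)).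
{ apply (RInt_correct (V := R_CompleteNormedModule)), ex_RInt_of_derivable.
  intros t; unfold f; auto_derive; auto. }
pose proof (is_RInt_sum_f_R0 g 0 (2 * PI) n Hg) as Hs.
rewrite (sum_eq _ (fun k => rho ^ k / INR (fact k) * phase_coef a th k)) in Hs.
2:{ intros k _; unfold g, phase_coef.
    exact (RInt_scal (V := R_CompleteNormedModule) _ _ _ _ (Hc k)). }
pose proof (is_RInt_minus (V := R_NormedModule) _ _ _ _ _ _ Hf Hs) as Hm.
replace (2 * PI) with (2 * PI - 0) at 1 by ring.
refine (norm_RInt_le_const (V := R_NormedModule) _ _ _ _ _ _ _ Hm).
- pose proof PI_RGT_0; lra.
- intros t _; change (Rabs (f t - sum_f_R0 (fun k => g k t) n)
    <= exp 1 * (exp rho * (rho ^ S n / INR (fact (S n))))).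
  pose proof (taylor_exp_cos (th - t) (a + 2 * t) rho n Hrho) as Ht.
  match type of Ht with Rabs ?D <= _ =>
    replace (f t - sum_f_R0 (fun k => g k t) n) with (exp (- cos (2 * t)) * D) end.
  + rewrite Rabs_mult, (Rabs_pos_eq (exp _)) by (left; apply exp_pos).
    apply Rmult_le_compat; [left; apply exp_pos|apply Rabs_pos| |exact Ht].
    apply exp_le_compat; pose proof (COS_bound (2 * t)); lra.
  + unfold f, exp_cos.
    replace (exp (rho * cos (th - t) - cos (2 * t)))
      with (exp (- cos (2 * t)) * exp (rho * cos (th - t)))
      by (rewrite <- exp_plus; f_equal; ring).
    rewrite Rmult_minus_distr_l, scal_sum.
    f_equal; [ring|].
    apply sum_eq; intros k _; unfold g; ring.
Qed.

Lemma phase_integral_series (a rho th : R) :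
  0 <= rho ->
  is_series (fun m => rho ^ (2 * m) / INR (fact (2 * m)) * kappa m
    * ((-1) ^ S m * cos (a + INR (2 * m) * th))) (phase_integral a rho th).
Proof.
intros Hrho; apply is_series_Reals; intros eps Heps.
set (Q := 2 * PI * (exp 1 * exp rho)).
assert (HQ : 0 < Q).
{ apply Rmult_lt_0_compat; [pose proof PI_RGT_0; lra|].
  apply Rmult_lt_0_compat; apply exp_pos. }
destruct (cv_speed_pow_fact rho (eps / Q)) as [N HN].
{ now apply Rdiv_lt_0_compat. }
exists N; intros n Hn.
(* Truncating at the odd index 2n + 1 groups the terms in pairs 2m, 2m + 1, of which the odd member
   vanishes. *)
pose proof (phase_integral_taylor a rho th (2 * n + 1) Hrho) as H.
rewrite sum_f_R0_pairs in H.
rewrite (sum_eq _ (fun m => rho ^ (2 * m) / INR (fact (2 * m)) * kappa m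
    * ((-1) ^ S m * cos (a + INR (2 * m) * th)))) in H.
2:{ intros m _; rewrite phase_coef_odd, phase_coef_even; ring. }
specialize (HN (S (2 * n + 1)) ltac:(lia)).
unfold Rdist in *; rewrite Rabs_minus_sym.
eapply Rle_lt_trans; [exact H|].
rewrite Rminus_0_r in HN.
apply Rle_lt_trans with
  (Q * Rabs (rho ^ S (2 * n + 1) / INR (fact (S (2 * n + 1))))).
- pose proof (Rle_abs (rho ^ S (2 * n + 1) / INR (fact (S (2 * n + 1))))).
  match goal with |- ?L <= _ => replace L with
    (Q * (rho ^ S (2 * n + 1) / INR (fact (S (2 * n + 1))))) by (unfold Q; ring) end.
  apply Rmult_le_compat_l; [lra|assumption].
- replace eps with (Q * (eps / Q)) by (field; lra).
  now apply Rmult_lt_compat_l.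
Qed.

(** * U in polar coordinates *)

Lemma polar_form (z : C) :
  exists th, z = (Cmod z * cos th, Cmod z * sin th).
Proof.
destruct (Req_dec (Cmod z) 0) as [H0|H0].
{ exists 0; rewrite (Cmod_eq_0 z H0), Cmod_0; unfold RtoC; f_equal; ring. }
pose proof (Cmod_ge_0 z) as Hp.
set (r := Cmod z) in *; set (c := fst z / r).
assert (Hr : r * r = fst z * fst z + snd z * snd z).
{ unfold r, Cmod; rewrite sqrt_sqrt; simpl; [ring|].
  pose proof (Rle_0_sqr (fst z)); pose proof (Rle_0_sqr (snd z)); unfold Rsqr in *; lra. }
assert (Hc : c * c + (snd z / r) * (snd z / r) = 1).
{ unfold c; transitivity ((fst z * fst z + snd z * snd z) / (r * r)); [now field|].
  rewrite <- Hr; now field. }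
assert (Hc1 : -1 <= c <= 1).
{ pose proof (Rle_0_sqr (snd z / r)); unfold Rsqr in *; split; nra. }
assert (Hs : sin (acos c) = Rabs (snd z / r)).
{ rewrite sin_acos by exact Hc1; rewrite <- sqrt_Rsqr_abs; f_equal; unfold Rsqr; lra. }
destruct z as [x y]; simpl in *.
destruct (Rle_dec 0 (y / r)) as [Hy|Hy].
- exists (acos c); rewrite cos_acos, Hs, Rabs_pos_eq by assumption.
  unfold c; f_equal; now field.
- exists (- acos c); rewrite cos_neg, sin_neg, cos_acos, Hs, Rabs_left by lra.
  unfold c; f_equal; now field.
Qed.

Lemma Cexp_Ci_mult (t : R) : Cexp (Ci * t)%C = (cos t, sin t).
Proof.
replace (Ci * t)%C with (0, t) by (apply injective_projections; simpl; ring).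
unfold Cexp; apply injective_projections; simpl; rewrite exp_0; ring.
Qed.

(** Since w^(-2) + w^2 = 2 cos 2t on the circle, the integrand is i w^2 exp(z/w - cos 2t) with z =
    rho e^{i th}, whose modulus and argument can be read off. *)
Lemma U_integrand (rho th t : R) :
  let w := Cexp (Ci * t)%C in
  (w * Cexp (((rho * cos th)%R, (rho * sin th)%R) / w - 1 / (2 * w ^ 2) - w ^ 2 / 2)
   * (Ci * w))%C =
  (exp (rho * cos (th - t) - cos (2 * t)) * - sin (2 * t + rho * sin (th - t)),
   exp (rho * cos (th - t) - cos (2 * t)) * cos (2 * t + rho * sin (th - t))).
Proof.
cbv zeta; rewrite Cexp_Ci_mult.
pose proof (sin2_cos2 t) as Hsc; unfold Rsqr in Hsc.
(* [v] is the conjugate of [w], hence its inverse; this removes the divisions from the identity. *)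
set (w := (cos t, sin t) : C); set (v := (cos t, - sin t) : C).
assert (Hwv : (w * v)%C = 1%C).
{ apply injective_projections; simpl; [lra|ring]. }
assert (Hw : w <> 0%C).
{ intros E; rewrite E, Cmult_0_l in Hwv; injection Hwv; lra. }
assert (Hv : v = (/ w)%C).
{ rewrite <- (Cmult_1_r (/ w)), <- Hwv; now field. }
assert (H2 : RtoC 2 <> 0%C) by (intros E; injection E; lra).
replace (((rho * cos th)%R, (rho * sin th)%R) / w - 1 / (2 * w ^ 2) - w ^ 2 / 2)%C
  with (((rho * cos th)%R, (rho * sin th)%R) * v - (v * v + w * w) / 2)%C
  by (rewrite Hv; field; repeat split; assumption).
replace (((rho * cos th)%R, (rho * sin th)%R) * v - (v * v + w * w) / 2)%C
  with (rho * cos (th - t) - cos (2 * t), rho * sin (th - t)).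
2:{ rewrite cos_minus, sin_minus, cos_2a.
    unfold w, v; apply injective_projections; simpl; field. }
rewrite cos_plus, sin_plus, sin_2a, cos_2a.
unfold Cexp, w; apply injective_projections; simpl; ring.
Qed.

Lemma U_polar (rho th : R) :
  U (rho * cos th, rho * sin th) =
  (phase_integral 0 rho th / (2 * PI), - phase_integral (PI / 2) rho th / (2 * PI)).
Proof.
unfold U, unit_circle_integral, C_RInt.
rewrite (RInt_eq _ (fun t => exp (rho * cos (th - t) - cos (2 * t))
    * cos (PI / 2 + 2 * t + rho * sin (th - t)))).
2:{ intros t; rewrite (U_integrand rho th t); simpl.
    rewrite sin_cos, Rplus_assoc; ring. }
rewrite (RInt_eq (fun t => Im _) (fun t => exp (rho * cos (th - t) - cos (2 * t))
    * cos (0 + 2 * t + rho * sin (th - t)))).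
2:{ intros t; rewrite (U_integrand rho th t); simpl; now rewrite Rplus_0_l. }
fold (phase_integral (PI / 2) rho th) (phase_integral 0 rho th).
pose proof PI_RGT_0.
apply injective_projections; simpl; field; lra.
Qed.

(** * The maximum modulus and its attainment on the imaginary axis *)

(** The left side is 2 PI times the real part of e^{-ia} U; taking a to be an argument of U makes it
    2 PI |U|. *)
Lemma phase_integral_rotate (a rho th : R) :
  cos a * phase_integral 0 rho th - sin a * phase_integral (PI / 2) rho th =
  phase_integral (- a) rho th.
Proof.
assert (Hex : forall b, ex_RInt (fun t => exp (rho * cos (th - t) - cos (2 * t))
    * cos (b + 2 * t + rho * sin (th - t))) 0 (2 * PI)).
{ intros b; apply ex_RInt_of_derivable; intros t; auto_derive; auto. }
unfold phase_integral.
unfold Rminus at 1; rewrite Ropp_mult_distr_l, <- RInt_linear by apply Hex.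
apply RInt_eq; intros t.
replace (cos (PI / 2 + 2 * t + rho * sin (th - t)))
  with (- sin (2 * t + rho * sin (th - t))) by (rewrite sin_cos, Rplus_assoc; ring).
replace (- a + 2 * t + rho * sin (th - t))
  with (2 * t + rho * sin (th - t) - a) by ring.
rewrite Rplus_0_l, (cos_minus _ a); ring.
Qed.

(* [2 PI |U(i r)|]: the phase [PI] makes every term of the series positive. *)
Definition peak (r : R) : R := phase_integral PI r (PI / 2).

Lemma cos_nat_PI (n : nat) : cos (INR n * PI) = (-1) ^ n.
Proof.
induction n as [|n IH]; [simpl; now rewrite Rmult_0_l, cos_0|].
rewrite S_INR, Rmult_plus_distr_r, Rmult_1_l, neg_cos, IH; simpl; ring.
Qed.

Lemma sin_nat_PI (n : nat) : sin (INR n * PI) = 0.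
Proof.
induction n as [|n IH]; [simpl; now rewrite Rmult_0_l, sin_0|].
rewrite S_INR, Rmult_plus_distr_r, Rmult_1_l, neg_sin, IH; ring.
Qed.

Definition peak_term (r : R) (m : nat) : R :=
  r ^ (2 * m) / INR (fact (2 * m)) * kappa m.

Lemma peak_term_nonneg (r : R) (m : nat) : 0 <= peak_term r m.
Proof.
apply Rmult_le_pos; [|left; apply kappa_pos].
apply Rdiv_le_0_compat; [|apply INR_fact_lt_0].
rewrite pow_mult; apply pow_le, pow2_ge_0.
Qed.

Lemma pow_m1_sqr (m : nat) : (-1) ^ m * (-1) ^ m = 1.
Proof.
rewrite <- Rpow_mult_distr; replace (-1 * -1) with 1 by ring; apply pow1.
Qed.

Lemma peak_series (r : R) : 0 <= r -> is_series (peak_term r) (peak r).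
Proof.
intros Hr.
refine (is_series_ext _ _ _ _ (phase_integral_series PI r (PI / 2) Hr)).
intros m.
change (peak_term r m * ((-1) ^ S m * cos (PI + INR (2 * m) * (PI / 2))) = peak_term r m).
replace (PI + INR (2 * m) * (PI / 2)) with (INR m * PI + PI)
  by (rewrite mult_INR; simpl (INR 2); field).
rewrite neg_cos, cos_nat_PI; simpl pow.
transitivity (peak_term r m * ((-1) ^ m * (-1) ^ m)); [ring|].
rewrite pow_m1_sqr; ring.
Qed.

(** Here 2m th is a multiple of PI, so cos(a + 2m th) = (-1)^m cos a: the signs cancel and -cos a
    factors out of the whole series. *)
Lemma phase_integral_imag (a r th : R) :
  0 <= r -> th = PI / 2 \/ th = - (PI / 2) ->
  phase_integral a r th = - cos a * peak r.
Proof.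
intros Hr Hth.
rewrite <- (is_series_unique _ _ (phase_integral_series a r th Hr)).
apply is_series_unique.
refine (is_series_ext _ _ _ _ (is_series_scal_l (- cos a) _ _ (peak_series r Hr))).
intros m.
change (- cos a * peak_term r m =
  peak_term r m * ((-1) ^ S m * cos (a + INR (2 * m) * th))).
replace (cos (a + INR (2 * m) * th)) with (cos a * (-1) ^ m).
- simpl pow; transitivity (- cos a * peak_term r m * ((-1) ^ m * (-1) ^ m)); [|ring].
  rewrite pow_m1_sqr; ring.
- destruct Hth as [-> | ->].
  + replace (a + INR (2 * m) * (PI / 2)) with (a + INR m * PI)
      by (rewrite mult_INR; simpl (INR 2); field).
    rewrite cos_plus, cos_nat_PI, sin_nat_PI; ring.
  + replace (a + INR (2 * m) * - (PI / 2)) with (a - INR m * PI)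
      by (rewrite mult_INR; simpl (INR 2); field).
    rewrite cos_minus, cos_nat_PI, sin_nat_PI; ring.
Qed.

Lemma is_series_le (u v : nat -> R) (a b : R) :
  (forall n, u n <= v n) -> is_series u a -> is_series v b -> a <= b.
Proof.
intros Huv Hu Hv.
refine (is_lim_seq_le (sum_n u) (sum_n v) a b _ Hu Hv).
intros n; apply sum_n_m_le; exact Huv.
Qed.

Lemma phase_integral_le_peak (a r th : R) :
  0 <= r -> phase_integral a r th <= peak r.
Proof.
intros Hr.
refine (is_series_le _ _ _ _ _ (phase_integral_series a r th Hr) (peak_series r Hr)).
intros m; fold (peak_term r m).
rewrite <- (Rmult_1_r (peak_term r m)) at 2.
apply Rmult_le_compat_l; [apply peak_term_nonneg|].
eapply Rle_trans; [apply Rle_abs|].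
rewrite Rabs_mult, pow_1_abs, Rmult_1_l.
apply Rabs_le, COS_bound.
Qed.

Lemma peak_term_le_peak (r : R) (m : nat) : 0 <= r -> peak_term r m <= peak r.
Proof.
intros Hr.
(* The series is compared with the one that keeps only its m-th term. *)
refine (is_series_le (fun n => if Nat.eq_dec n m then peak_term r m else 0) _ _ _ _ _
  (peak_series r Hr)).
- intros n; destruct (Nat.eq_dec n m) as [->|]; [lra|apply peak_term_nonneg].
- apply is_series_Reals; intros eps Heps; exists m; intros n Hn.
  replace (sum_f_R0 _ n) with (peak_term r m); [now rewrite Rdist_eq|].
  induction Hn as [|n Hn IH].
  + destruct m as [|m]; [reflexivity|].
    rewrite tech5; destruct (Nat.eq_dec (S m) (S m)) as [_|]; [|congruence].
    rewrite (sum_eq _ (fun _ => 0)), sum_cte; [ring|].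
    intros i Hi; destruct (Nat.eq_dec i (S m)); [lia|reflexivity].
  + rewrite tech5, <- IH; destruct (Nat.eq_dec (S n) m); [lia|ring].
Qed.

Lemma peak_pos (r : R) : 0 <= r -> 0 < peak r.
Proof.
intros Hr; eapply Rlt_le_trans; [|now apply (peak_term_le_peak r 0)].
unfold peak_term; simpl; pose proof (bessel_pos 1); lra.
Qed.

Lemma U_imag_axis (r th : R) :
  0 <= r -> th = PI / 2 \/ th = - (PI / 2) ->
  U (r * cos th, r * sin th) = RtoC (- (peak r / (2 * PI))).
Proof.
intros Hr Hth.
rewrite U_polar, !phase_integral_imag by assumption.
rewrite cos_0, cos_PI2; pose proof PI_RGT_0.
unfold RtoC; f_equal; field; lra.
Qed.

Lemma Cmod_U_imag_axis (r th : R) :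
  0 <= r -> th = PI / 2 \/ th = - (PI / 2) ->
  Cmod (U (r * cos th, r * sin th)) = peak r / (2 * PI).
Proof.
intros Hr Hth; rewrite U_imag_axis, Cmod_R, Rabs_Ropp by assumption.
apply Rabs_pos_eq, Rdiv_le_0_compat; [now left; apply peak_pos|].
pose proof PI_RGT_0; lra.
Qed.

(** With [al] an argument of U(z), |U(z)| is the real part of e^{-i al} U(z), hence a single phase
    integral over 2 PI, and its series is dominated termwise by that of [peak]. *)
Lemma Cmod_U_le (z : C) : Cmod (U z) <= peak (Cmod z) / (2 * PI).
Proof.
destruct (polar_form z) as [th Hz].
destruct (polar_form (U z)) as [al Hu].
pose proof (Cmod_ge_0 z) as Hr; set (r := Cmod z) in *.
set (M := Cmod (U z)) in *.
rewrite Hz, U_polar in Hu; injection Hu; intros Hy Hx.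
apply Rle_trans with (phase_integral (- al) r th / (2 * PI)).
- rewrite <- phase_integral_rotate.
  match goal with |- _ <= ?E => replace E with
    (cos al * (phase_integral 0 r th / (2 * PI))
     + sin al * (- phase_integral (PI / 2) r th / (2 * PI))) end.
  2:{ pose proof PI_RGT_0; field; lra. }
  rewrite Hx, Hy; pose proof (sin2_cos2 al) as H; unfold Rsqr in H.
  apply Req_le; transitivity (M * (sin al * sin al + cos al * cos al)); [rewrite H|]; ring.
- apply Rmult_le_compat_r; [|now apply phase_integral_le_peak].
  left; apply Rinv_0_lt_compat; pose proof PI_RGT_0; lra.
Qed.

Lemma max_modulus_U (r : R) : 0 <= r -> max_modulus r U = peak r / (2 * PI).
Proof.
intros Hr; apply max_modulus_unique; split.
- exists (r * cos (PI / 2), r * sin (PI / 2)); split.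
  + rewrite cos_PI2, sin_PI2, Rmult_0_r, Rmult_1_r.
    unfold Cmod; simpl fst; simpl snd.
    rewrite pow_i, Rplus_0_l by lia; now apply sqrt_pow2.
  + apply Cmod_U_imag_axis; [exact Hr|now left].
- intros z <-; apply Cmod_U_le.
Qed.

(** * Upper and lower bounds for the growth of [peak] *)

Lemma exp_term_le (x : R) (n : nat) : 0 <= x -> x ^ n / INR (fact n) <= exp x.
Proof.
intros Hx; eapply Rle_trans; [|apply (exp_ge_taylor x n Hx)].
destruct n as [|n]; [simpl; lra|].
rewrite tech5; pose proof (cond_pos_sum (fun k => x ^ k / INR (fact k)) n) as H.
enough (0 <= sum_f_R0 (fun k => x ^ k / INR (fact k)) n) by lra.
apply H; intros k; apply Rdiv_le_0_compat; [now apply pow_le|apply INR_fact_lt_0].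
Qed.

Lemma sum_even_exp_le (x : R) (n : nat) :
  0 <= x -> sum_f_R0 (fun m => x ^ (2 * m) / INR (fact (2 * m))) n <= exp x.
Proof.
intros Hx; eapply Rle_trans; [|apply (exp_ge_taylor x (2 * n + 1) Hx)].
rewrite sum_f_R0_pairs; apply sum_Rle; intros m _.
enough (0 <= x ^ (2 * m + 1) / INR (fact (2 * m + 1))) by lra.
apply Rdiv_le_0_compat; [now apply pow_le|apply INR_fact_lt_0].
Qed.

(** For m = j + 1 and y = q^2, the upper bound on I_j leaves y times one term of the series of
    exp(y/2). The factor q^2 accounts for the index shift in [kappa]. *)
Lemma kappa_upper (q : R) (m : nat) :
  1 <= q -> kappa m * q ^ (2 * m) <= bessel 0 * (q ^ 2 * exp (q ^ 2 / 2)).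
Proof.
intros Hq; pose proof bessel_0_pos as H0; assert (Hq2 : 1 <= q ^ 2) by nra.
destruct m as [|j]; simpl kappa.
- rewrite Nat.mul_0_r, pow_O, Rmult_1_r.
  apply Rle_trans with (bessel 0 * 1); [rewrite Rmult_1_r; apply bessel_le_0|].
  apply Rmult_le_compat_l; [lra|].
  rewrite <- (Rmult_1_r 1); apply Rmult_le_compat; try lra.
  rewrite <- exp_0; apply exp_le_compat; lra.
- rewrite pow_mult; set (y := q ^ 2) in *.
  apply Rle_trans with (bessel 0 * ((/ 2) ^ j / INR (fact j)) * y ^ S j).
  + apply Rmult_le_compat_r; [apply pow_le; lra|apply bessel_upper].
  + replace (bessel 0 * ((/ 2) ^ j / INR (fact j)) * y ^ S j)
      with (bessel 0 * (y * ((y / 2) ^ j / INR (fact j))))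
      by (unfold Rdiv; rewrite Rpow_mult_distr; simpl; ring).
    apply Rmult_le_compat_l; [lra|]; apply Rmult_le_compat_l; [lra|].
    apply exp_term_le; lra.
Qed.

(** Writing r^(2m) as (r/q)^(2m) q^(2m) and bounding [kappa m * q ^ (2 * m)] uniformly in m leaves
    the even part of the series of exp(r/q). *)
Lemma peak_upper (r q : R) :
  0 <= r -> 1 <= q ->
  peak r <= bessel 0 * (q ^ 2 * exp (q ^ 2 / 2)) * exp (r / q).
Proof.
intros Hr Hq; set (M := bessel 0 * (q ^ 2 * exp (q ^ 2 / 2))).
assert (HM : 0 <= M).
{ apply Rmult_le_pos; [left; apply bessel_0_pos|].
  apply Rmult_le_pos; [apply pow2_ge_0|left; apply exp_pos]. }
refine (is_lim_seq_le (sum_n (peak_term r)) (fun _ => M * exp (r / q)) (peak r) _ _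
  (peak_series r Hr) (is_lim_seq_const _)).
intros n; rewrite sum_n_Reals.
apply Rle_trans with (M * sum_f_R0 (fun m => (r / q) ^ (2 * m) / INR (fact (2 * m))) n).
- rewrite scal_sum; apply sum_Rle; intros m _; unfold peak_term.
  assert (Hqm : 0 < q ^ (2 * m)) by (apply pow_lt; lra).
  replace (r ^ (2 * m) / INR (fact (2 * m)) * kappa m)
    with ((r / q) ^ (2 * m) / INR (fact (2 * m)) * (kappa m * q ^ (2 * m))).
  + apply Rmult_le_compat_l; [|now apply kappa_upper].
    apply Rdiv_le_0_compat; [|apply INR_fact_lt_0].
    apply pow_le, Rdiv_le_0_compat; lra.
  + unfold Rdiv; rewrite Rpow_mult_distr, pow_inv; field.
    split; [apply INR_fact_neq_0|lra].
- apply Rmult_le_compat_l; [exact HM|].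
  apply sum_even_exp_le, Rdiv_le_0_compat; lra.
Qed.

(** Logarithm of n! <= e n (n/e)^n. The induction step amounts to ln(n/(n+1)) <= -1/(n+1). *)
Lemma ln_fact_upper (n : nat) :
  (1 <= n)%nat ->
  ln (INR (fact n)) <= 1 + ln (INR n) + INR n * ln (INR n) - INR n.
Proof.
intros Hn; induction Hn as [|n Hn IH].
- simpl; rewrite ln_1; lra.
- assert (Hp : 0 < INR n) by (apply lt_0_INR; lia).
  rewrite fact_simpl, mult_INR, ln_mult;
    [|apply lt_0_INR; lia|apply INR_fact_lt_0].
  rewrite S_INR in *; set (x := INR n) in *.
  assert (H : ln (x / (x + 1)) <= - / (x + 1)).
  { assert (Hx : 0 < x / (x + 1)) by (apply Rdiv_lt_0_compat; lra).
    pose proof (exp_ineq1_le (ln (x / (x + 1)))) as H.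
    rewrite exp_ln in H by exact Hx.
    replace (- / (x + 1)) with (x / (x + 1) - 1) by (field; lra); lra. }
  rewrite ln_div in H by lra.
  assert (H1 : (x + 1) * (ln x - ln (x + 1)) <= -1).
  { replace (-1) with ((x + 1) * - / (x + 1)) by (field; lra).
    apply Rmult_le_compat_l; lra. }
  lra.
Qed.

(** Since [kappa m] is the Bessel value of index m - 1, the denominator in its lower bound is
    exactly 2^(m-1) m!, whence the summand [ln 2]. *)
Lemma peak_term_lower (r : R) (m : nat) :
  (1 <= m)%nat -> 0 < r ->
  ln (bessel 0) + INR (2 * m) * ln r - ln (INR (fact (2 * m))) + ln 2
    - INR m * ln 2 - ln (INR (fact m))
  <= ln (peak_term r m).
Proof.
intros Hm Hr; destruct m as [|j]; [lia|].
set (c := r ^ (2 * S j) / INR (fact (2 * S j))).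
assert (Hf := INR_fact_lt_0); assert (Hb := bessel_0_pos).
assert (Hc : 0 < c) by (apply Rdiv_lt_0_compat; [now apply pow_lt|apply Hf]).
assert (H2 : 0 < (/ 2) ^ j) by (apply pow_lt; lra).
assert (Hd : 0 < (/ 2) ^ j / INR (fact (S j))) by now apply Rdiv_lt_0_compat.
apply Rle_trans with (ln (c * (bessel 0 * ((/ 2) ^ j / INR (fact (S j)))))).
- rewrite (ln_mult c), (ln_mult (bessel 0))
    by first [assumption | now apply Rmult_lt_0_compat].
  unfold c; rewrite !ln_div, !ln_pow, ln_Rinv
    by first [apply Hf | assumption | now apply pow_lt | lra].
  rewrite (S_INR j); lra.
- apply ln_le; [apply Rmult_lt_0_compat; [exact Hc|now apply Rmult_lt_0_compat]|].
  apply Rmult_le_compat_l; [left; exact Hc|]; simpl kappa.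
  rewrite fact_simpl, mult_INR, (Rmult_comm (INR (S j))); apply bessel_lower.
Qed.

Lemma ln_peak_upper (r : R) :
  1 <= r ->
  ln (peak r) <= ln (bessel 0) + 2 / 3 * ln r + 3 / 2 * Rpower r (2 / 3).
Proof.
(* This q minimises q^2/2 + r/q, with minimum (3/2) r^(2/3). *)
intros Hr; set (q := Rpower r (1 / 3)).
assert (Hq : 1 <= q).
{ apply Rle_trans with (Rpower r 0); [rewrite Rpower_O; lra|apply Rle_Rpower; lra]. }
assert (Hq2 : q ^ 2 = Rpower r (2 / 3)).
{ unfold q; rewrite <- Rpower_pow by apply exp_pos.
  rewrite Rpower_mult; f_equal; simpl; field. }
assert (Hrq : r / q = Rpower r (2 / 3)).
{ unfold q; rewrite <- (Rpower_1 r) at 1 by lra.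
  unfold Rdiv; rewrite <- Rpower_Ropp, <- Rpower_plus; f_equal; field. }
pose proof (peak_upper r q ltac:(lra) Hq) as H.
assert (Hp : 0 < peak r) by (apply peak_pos; lra).
pose proof (ln_le _ _ Hp H) as Hl.
assert (Hb := bessel_0_pos).
assert (Hx : 0 < Rpower r (2 / 3)) by apply exp_pos.
rewrite Hrq, Hq2, !ln_mult, !ln_exp in Hl
  by repeat first [assumption | apply exp_pos | apply Rmult_lt_0_compat].
unfold Rpower at 1 in Hl; rewrite ln_exp in Hl; lra.
Qed.

Lemma ln_peak_lower (r : R) :
  exp 3 <= r ->
  ln (bessel 0) - 5 - 4 / 3 * ln r + 3 / 2 * Rpower r (2 / 3) <= ln (peak r).
Proof.
intros Hr; assert (Hr0 : 0 < r) by (eapply Rlt_le_trans; [apply exp_pos|exact Hr]).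
set (x := Rpower r (2 / 3)).
assert (HL : 3 <= ln r).
{ rewrite <- (ln_exp 3); apply ln_le; [apply exp_pos|exact Hr]. }
assert (Hx : 3 <= x).
{ unfold x, Rpower; pose proof (exp_ineq1_le (2 / 3 * ln r)); lra. }
(* The ratio of consecutive terms r^(2m) / (2^m m! (2m)!) is about r^2 / (8 m^3), so the largest one
   is near m = r^(2/3) / 2. The assumption on r gives x >= 3 and thus m >= 1. *)
destruct (nfloor_ex (x / 2)) as [m Hm]; [lra|].
assert (Hm1 : (1 <= m)%nat) by (destruct m; [simpl in Hm; lra|lia]).
assert (Hn : 0 < INR m) by (apply lt_0_INR; lia).
eapply Rle_trans; [|apply ln_le; [|apply (peak_term_le_peak r m); lra]].
2:{ destruct m as [|j]; [lia|].
    apply Rmult_lt_0_compat; [|apply kappa_pos].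
    apply Rdiv_lt_0_compat; [now apply pow_lt|apply INR_fact_lt_0]. }
eapply Rle_trans; [|now apply peak_term_lower].
pose proof (ln_fact_upper m Hm1) as H1.
pose proof (ln_fact_upper (2 * m) ltac:(lia)) as H2.
assert (E2m : INR (2 * m) = 2 * INR m) by (rewrite mult_INR; simpl; ring).
rewrite E2m, ln_mult in * by lra.
assert (Hln : ln (INR m) <= 2 / 3 * ln r - ln 2).
{ replace (2 / 3 * ln r - ln 2) with (ln (x / 2)).
  - apply ln_le; lra.
  - rewrite ln_div by lra; unfold x, Rpower; rewrite ln_exp; ring. }
pose proof ln_lt_2.
(* With the factorial bounds inserted, the estimate is ln(I_0) up to a constant factor inside, plus
   this product, plus 3m - 2 - 2 ln m. Then m > x/2 - 1 yields (3/2) x - 5, and the bound on ln m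
   yields -(4/3) ln r. *)
assert (Hmain : 0 <= INR m * (2 * ln r - 3 * ln 2 - 3 * ln (INR m)))
  by (apply Rmult_le_pos; lra).
lra.
Qed.

(** * Asymptotics of the logarithm of the maximum modulus *)

Lemma ln_max_modulus_U (r : R) :
  exp 3 <= r ->
  Rabs (ln (max_modulus r U) - 3 / 2 * Rpower r (2 / 3)) <=
  Rabs (ln (bessel 0) - ln (2 * PI)) + 5 + 4 / 3 * ln r.
Proof.
intros Hr; assert (Hr1 : 1 <= r).
{ eapply Rle_trans; [|exact Hr]; pose proof (exp_ineq1_le 3); lra. }
pose proof PI_RGT_0.
rewrite max_modulus_U, ln_div by (try apply peak_pos; lra).
pose proof (ln_peak_upper r Hr1); pose proof (ln_peak_lower r Hr).
assert (HL : 0 <= ln r) by (rewrite <- ln_1; apply ln_le; lra).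
pose proof (Rle_abs (ln (bessel 0) - ln (2 * PI))).
pose proof (Rle_abs (- (ln (bessel 0) - ln (2 * PI)))) as Hneg.
rewrite Rabs_Ropp in Hneg.
apply Rabs_le; lra.
Qed.

(** Reduces the relative error to a multiple of 1 / ln r. With q = r^(1/3), the inequality exp(u) >=
    1 + u gives q >= (ln r)/3 >= 1, so the numerator is at most (A + 4) q. *)
Lemma ln_div_Rpower_le (r A : R) :
  exp 3 <= r -> 0 <= A ->
  (A + 4 / 3 * ln r) / Rpower r (2 / 3) <= (3 * A + 12) / ln r.
Proof.
intros Hr HA.
assert (HL : 3 <= ln r).
{ rewrite <- (ln_exp 3); apply ln_le; [apply exp_pos|exact Hr]. }
set (q := Rpower r (1 / 3)).
assert (Hq2 : Rpower r (2 / 3) = q * q).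
{ unfold q; rewrite <- Rpower_plus; f_equal; field. }
assert (Hq : ln r / 3 <= q).
{ unfold q, Rpower; pose proof (exp_ineq1_le (1 / 3 * ln r)); lra. }
rewrite Hq2.
apply Rle_trans with ((A + 4) / q).
- replace ((A + 4) / q) with ((A + 4) * q / (q * q)) by (field; lra).
  apply Rmult_le_compat_r; [left; apply Rinv_0_lt_compat; nra|nra].
- replace ((3 * A + 12) / ln r) with ((A + 4) * / (ln r / 3)) by (field; lra).
  apply Rmult_le_compat_l; [lra|]; apply Rinv_le_contravar; lra.
Qed.

Theorem theorem10 :
  ((forall r : R, 0 < r ->
      Cmod (U (Ci * r)%C) = Cmod (U (- Ci * r)%C) /\
      Cmod (U (- Ci * r)%C) = max_modulus r U) /\
   (exists c0 : R, 0 < c0 /\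
      exists eps : R -> R,
        is_lim eps p_infty 0 /\
        Rbar_locally p_infty (fun r : R =>
          ln (max_modulus r U) = (c0 + eps r) * Rpower r (2 / 3)))) /\
  (forall z : C, Re z = 0 -> U z <> RtoC 0).
Proof.
assert (Hpi := PI_RGT_0).
split; [split|].
- intros r Hr.
  replace (Ci * r)%C with (r * cos (PI / 2), r * sin (PI / 2)).
  2:{ rewrite cos_PI2, sin_PI2; apply injective_projections; simpl; ring. }
  replace (- Ci * r)%C with (r * cos (- (PI / 2)), r * sin (- (PI / 2))).
  2:{ rewrite cos_neg, sin_neg, cos_PI2, sin_PI2.
      apply injective_projections; simpl; ring. }
  rewrite max_modulus_U, !Cmod_U_imag_axis by (auto; lra).
  now split.
- exists (3 / 2); split; [lra|].
  (* The error is defined by solving the required identity for it, so only its limit needs an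
     estimate. *)
  exists (fun r => ln (max_modulus r U) / Rpower r (2 / 3) - 3 / 2).
  split.
  2:{ exists 0; intros r _; field; apply Rgt_not_eq, exp_pos. }
  set (A := Rabs (ln (bessel 0) - ln (2 * PI)) + 5).
  assert (HA : 0 <= A) by (pose proof (Rabs_pos (ln (bessel 0) - ln (2 * PI))); unfold A; lra).
  assert (Hlim : forall B, is_lim (fun r => B / ln r) p_infty 0).
  { intros B; replace (Finite 0) with (Rbar_mult B (Rbar_inv p_infty))
      by (simpl; f_equal; ring).
    apply is_lim_scal_l, is_lim_inv; [apply is_lim_ln_p|discriminate]. }
  apply (is_lim_le_le_loc (fun r => - (3 * A + 12) / ln r) (fun r => (3 * A + 12) / ln r));
    try apply Hlim.
  exists (exp 3); intros r Hr; apply Rlt_le in Hr.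
  pose proof (ln_max_modulus_U r Hr) as H; fold A in H.
  pose proof (ln_div_Rpower_le r A Hr HA) as H'.
  assert (Hx : 0 < Rpower r (2 / 3)) by apply exp_pos.
  replace (- (3 * A + 12) / ln r) with (- ((3 * A + 12) / ln r)) by (unfold Rdiv; ring).
  apply Rabs_le_between.
  eapply Rle_trans; [|exact H'].
  replace (ln (max_modulus r U) / Rpower r (2 / 3) - 3 / 2)
    with ((ln (max_modulus r U) - 3 / 2 * Rpower r (2 / 3)) / Rpower r (2 / 3))
    by (field; lra).
  unfold Rdiv at 1; rewrite Rabs_mult, (Rabs_pos_eq (/ _))
    by (left; now apply Rinv_0_lt_compat).
  apply Rmult_le_compat_r; [left; now apply Rinv_0_lt_compat|exact H].
(* On the imaginary axis, the origin included, U equals [- peak / (2 PI)], which is negative. *)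
- intros [x y] Hx; simpl in Hx; subst x.
  assert (H : exists th, (th = PI / 2 \/ th = - (PI / 2)) /\
    (0, y) = (Rabs y * cos th, Rabs y * sin th)).
  { destruct (Rle_dec 0 y) as [Hy|Hy]; [exists (PI / 2)|exists (- (PI / 2))].
    - rewrite cos_PI2, sin_PI2, Rabs_pos_eq by exact Hy.
      split; [now left|f_equal; ring].
    - rewrite cos_neg, sin_neg, cos_PI2, sin_PI2, Rabs_left by lra.
      split; [now right|f_equal; ring]. }
  destruct H as [th [Hth ->]].
  pose proof (peak_pos _ (Rabs_pos y)) as Hp.
  rewrite U_imag_axis by (try apply Rabs_pos; exact Hth).
  intros E; injection E; intros E0.
  assert (0 < peak (Rabs y) / (2 * PI)) by (apply Rdiv_lt_0_compat; lra).
  lra.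
Qed.
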